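(* For any triplet of real numbers $(p,q,\gamma)$ with $p,q\ge2$, we have $$\sup_{u\in L^2(\mathbb{R},\mathbb{C})\setminus\{0\}}\frac{\left\||D_x|^\gamma e^{-t\partial_x^3}u\right\|_{L^p_tL^q_x}}{\|u\|_{L^2_x}}=\sup_{u\in L^2(\mathbb{R},\mathbb{R})\setminus\{0\}}\frac{\left\||D_x|^\gamma e^{-t\partial_x^3}u\right\|_{L^p_tL^q_x}}{\|u\|_{L^2_x}}.$$ Moreover, there is a maximizer for the supremum on the left side if and only if there is one for the supremum on the right side.
   Context: Fourier transform: $\hat u(\xi)=\frac1{\sqrt{2\pi}}\int_{\mathbb{R}}u(x)e^{-ix\xi}\,dx$. The operators $|D_x|^{\gamma}$ and $e^{-t\partial_x^3}$ act in the variable $x\in\mathbb{R}$ as the Fourier multipliers $|\xi|^\gamma$ and $e^{it\xi^3}$. The mixed norm is $\|F\|_{L^p_tL^q_x}:=\left(\int_{\mathbb{R}}\left(\int_{\mathbb{R}}|F(t,x)|^q\,dx\right)^{p/q}dt\right)^{1/p}$, understood as $+\infty$ if $F$ does not belong to $L^p_tL^q_x$ (so the suprema take values in $[0,\infty]$). $L^2(\mathbb{R},\mathbb{C})$ and $L^2(\mathbb{R},\mathbb{R})$ denote the complex-valued and the real-valued square-integrable functions. A maximizer is an admissible $u$ at which the supremum is attained. *)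

(* Defs.v *)
From HB Require Import structures.
From mathcomp Require Import all_boot all_order all_algebra.
From mathcomp Require Import all_classical all_reals all_analysis.
From mathcomp Require Export complex.

Set Implicit Arguments.
Unset Strict Implicit.
Unset Printing Implicit Defensive.

Import Order.TTheory GRing.Theory Num.Theory.
Import numFieldNormedType.Exports.

Local Open Scope classical_set_scope.
Local Open Scope ring_scope.
Local Open Scope complex_scope.

(* The library puts no sigma-algebra and no integral on R[i]: measurability,
   integrability and integrals are taken on real and imaginary parts. *)
Section complex_valued.
Context {d : measure_display} {T : measurableType d} {R : realType}.
Variable mu : {measure set T -> \bar R}.
Implicit Types (f : T -> R[i]) (D : set T).

Definition cmeasurable f : Prop :=
  measurable_fun setT (fun x => complex.Re (f x)) /\
  measurable_fun setT (fun x => complex.Im (f x)).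

Definition cintegrable D f : Prop :=
  mu.-integrable D (fun x => (complex.Re (f x))%:E) /\
  mu.-integrable D (fun x => (complex.Im (f x))%:E).

Definition cintegral D f : R[i] :=
  Rintegral mu D (fun x => complex.Re (f x)) +i*
  Rintegral mu D (fun x => complex.Im (f x)).

Definition cLnorm (r : R) f : \bar R :=
  Lnorm mu r%:E (fun x => (ComplexField.Normc.normc (f x))%:E).

End complex_valued.

Section airy.
Context {R : realType}.
Local Notation leb := (@lebesgue_measure R).

Definition expi (x : R) : R[i] := cos x +i* sin x.

Definition L2norm (u : R -> R[i]) : \bar R := cLnorm leb 2 u.

Definition L2 (u : R -> R[i]) : Prop :=
  cmeasurable (u : measurableTypeR R -> R[i]) /\ (L2norm u < +oo)%E.

Definition fourier_integral (D : set R) (u : R -> R[i]) (xi : R) : R[i] :=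
  ((Num.sqrt (2 * pi))^-1)%:C *
  cintegral leb D (fun x => u x * expi (- (x * xi))).

(* v is the Fourier-Plancherel transform of u in L^2: the L^2 limit of the
   Fourier integrals of the truncations of u to [-n, n]. *)
Definition is_fourier (u v : R -> R[i]) : Prop :=
  L2 v /\
  (fun n : nat =>
     L2norm (fun xi => v xi - fourier_integral `[- n%:R, n%:R] u xi))
    @ \oo --> 0%E.

Definition real_schwartz (f : R -> R) : Prop :=
  forall n : nat,
    (forall x, derivable (derive1n n f) x 1) /\
    (forall m : nat, exists C : R, forall x, `|x| ^+ m * `|derive1n n f x| <= C).

Definition schwartz (phi : R -> R[i]) : Prop :=
  real_schwartz (fun x => complex.Re (phi x)) /\
  real_schwartz (fun x => complex.Im (phi x)).

(* g is the function whose Fourier transform, as a tempered distribution, is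
   the locally integrable function m : <g, phi^> = <m, phi>. *)
Definition is_inverse_fourier (m g : R -> R[i]) : Prop :=
  forall phi, schwartz phi ->
    [/\ cintegrable leb setT (fun xi => m xi * phi xi),
        cintegrable leb setT (fun x => g x * fourier_integral setT phi x) &
        cintegral leb setT (fun x => g x * fourier_integral setT phi x) =
        cintegral leb setT (fun xi => m xi * phi xi)].

Definition airy_multiplier (gamma t xi : R) : R[i] :=
  (`|xi| `^ gamma)%:C * expi (t * xi ^+ 3).

(* The measurable function F (t, x) represents |D_x|^gamma e^{-t d_x^3} u. *)
Definition is_airy (gamma : R) (u : R -> R[i]) (F : R * R -> R[i]) : Prop :=
  cmeasurable (F : measurableTypeR R * measurableTypeR R -> R[i]) /\
  exists2 v : R -> R[i], is_fourier u v &
    {ae leb, forall t : R, is_inverse_fourier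
       (fun xi => airy_multiplier gamma t xi * v xi) (fun x => F (t, x))}.

Definition mixed_norm (p q : R) (F : R * R -> R[i]) : \bar R :=
  Lnorm leb p%:E (fun t : R => cLnorm leb q (fun x : R => F (t, x))).

(* The norm of |D_x|^gamma e^{-t d_x^3} u in L^p_t L^q_x.  Two representing
   functions are equal almost everywhere, so the infimum is over at most one
   value.  It is +oo when no function represents |D_x|^gamma e^{-t d_x^3} u, in
   particular when |xi|^gamma u^ is not locally integrable. *)
Definition airy_norm (p q gamma : R) (u : R -> R[i]) : \bar R :=
  ereal_inf [set mixed_norm p q F | F in [set F | is_airy gamma u F]].

Definition airy_quotient (p q gamma : R) (u : R -> R[i]) : \bar R :=
  (airy_norm p q gamma u / L2norm u)%E.

(* L^2(R, C) \ {0} and L^2(R, R) \ {0}; u is nonzero as a class when its norm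
   is nonzero. *)
Definition L2C_nonzero : set (R -> R[i]) :=
  [set u | L2 u /\ L2norm u != 0%E].

Definition L2R_nonzero : set (R -> R[i]) :=
  [set u | L2C_nonzero u /\ forall x, complex.Im (u x) = 0].

Definition airy_sup (p q gamma : R) (A : set (R -> R[i])) : \bar R :=
  ereal_sup [set airy_quotient p q gamma u | u in A].

Definition has_maximizer (p q gamma : R) (A : set (R -> R[i])) : Prop :=
  exists2 u, A u & airy_quotient p q gamma u = airy_sup p q gamma A.

End airy.

(* Main.v *)
(* Write u = u_1 + i u_2 with u_1, u_2 real.  The evolution commutes with complex
   conjugation, so it maps u_1 and u_2 to real functions F_1 and F_2, and
   |F|^2 = F_1^2 + F_2^2.  As p, q >= 2, Minkowski's inequality in L^{q/2} and
   L^{p/2} gives ||F||^2 <= ||F_1||^2 + ||F_2||^2, while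
   ||u||^2 = ||u_1||^2 + ||u_2||^2; hence the quotient at u is at most the larger
   of the quotients at those of u_1, u_2 that are nonzero.  So every complex u is
   dominated by a real w, which gives both claims. *)

(* Conjugating a function replaces its transform $v(\xi)$ by $\overline{v(-\xi)}$. Since
   $|\xi|^\gamma$ is even and $\xi^3$ is odd, the multiplier is invariant under the same operation;
   this is why the evolution commutes with conjugation.

   The evolution is encoded as a relation and [airy_norm] as an infimum over representatives,
   possibly over none. Quotients are therefore compared through strict bounds: an infimum below a
   real number hands out an actual representative, whose real part can then be used. Two
   difficulties follow. A component of norm zero has no admissible quotient; it is represented by 0
   and yields only a weak inequality, so strictness must come from the other component. And for
   arbitrary [gamma] a quotient may be [+oo]; domination by a real function is therefore proved by
   contradiction, with a real bound [M] that depends on whether the quotient of [u] is finite. *)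
Require Import Defs.
From mathcomp Require Import all_boot all_order all_algebra.
From mathcomp Require Import all_classical all_reals all_analysis.
From mathcomp Require Import measurable_realfun ring lra.

Set Implicit Arguments.
Unset Strict Implicit.
Unset Printing Implicit Defensive.

Import Order.TTheory GRing.Theory Num.Theory.
Import numFieldNormedType.Exports.

Local Open Scope classical_set_scope.
Local Open Scope ring_scope.
Local Open Scope complex_scope.

(** * Minkowski's inequality for functions with values in $[0,+\infty]$, and its squared form *)

Section Lnorm_facts.
Context {d : measure_display} {T : measurableType d} {R : realType}.
Variable mu : {measure set T -> \bar R}.
Implicit Types f g h : T -> \bar R.

Lemma ge0_measurable_poweR f (r : R) :
  measurable_fun setT f -> measurable_fun setT (fun x => f x `^ r)%E.
Proof. by move=> mf; apply: (measurableT_comp (measurable_poweR r)). Qed.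

Lemma ae_ge0_le_Lnorm (r : R) f g : 0 < r ->
  measurable_fun setT f -> measurable_fun setT g ->
  (forall x, 0 <= f x)%E -> (forall x, 0 <= g x)%E ->
  {ae mu, forall x, (f x <= g x)%E} ->
  (Lnorm mu r%:E f <= Lnorm mu r%:E g)%E.
Proof.
move=> r0 mf mg f0 g0 fg; rewrite unlock.
have i0 h : (0 <= \int[mu]_x `|h x| `^ r)%E.
  by apply: integral_ge0 => x _; exact: poweR_ge0.
apply: gt0_ler_poweR.
- by rewrite invr_ge0 ltW.
- by rewrite in_itv/= i0 leey.
- by rewrite in_itv/= i0 leey.
apply: ae_ge0_le_integral => //.
- by move=> x _; exact: poweR_ge0.
- by apply: ge0_measurable_poweR; exact: measurableT_comp.
- by move=> x _; exact: poweR_ge0.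
- by apply: ge0_measurable_poweR; exact: measurableT_comp.
move: fg; apply: filterS => x fg _.
rewrite !gee0_abs//; apply: gt0_ler_poweR => //.
- exact: ltW.
- by rewrite in_itv/= f0 leey.
- by rewrite in_itv/= g0 leey.
Qed.

Lemma ge0_le_Lnorm (r : R) f g : 0 < r ->
  measurable_fun setT f -> measurable_fun setT g ->
  (forall x, 0 <= f x)%E -> (forall x, f x <= g x)%E ->
  (Lnorm mu r%:E f <= Lnorm mu r%:E g)%E.
Proof.
move=> r0 mf mg f0 fg; apply: ae_ge0_le_Lnorm => //.
- by move=> x; rewrite (le_trans (f0 x)).
- exact: aeW.
Qed.

Lemma ge0_Lnorm_lty_ae (r : R) f : 0 < r ->
  measurable_fun setT f -> (forall x, 0 <= f x)%E ->
  (Lnorm mu r%:E f < +oo)%E -> {ae mu, forall x, f x \is a fin_num}.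
Proof.
move=> r0 mf f0 foo.
have mfr : measurable_fun setT (fun x => `|f x| `^ r)%E.
  by apply: ge0_measurable_poweR; exact: measurableT_comp.
have : mu.-integrable setT (fun x => `|f x| `^ r)%E.
  apply/integrableP; split => //.
  under eq_integral do rewrite gee0_abs ?poweR_ge0//.
  by rewrite -poweR_Lnorm ?gt_eqF// poweR_lty.
move=> /(integrable_ae measurableT); apply: filterS => x /(_ I).
rewrite gee0_abs//; have := f0 x; case: (f x) => // _.
by rewrite poweRyr ?gt_eqF.
Qed.

(** Infinite values are allowed because the lemma is later applied to
    $t\mapsto\|F(t,\cdot)\|_{L^q}$, which may be infinite for some $t$. If both norms on the right
    are finite, [g] and [h] are finite almost everywhere, and the real-valued Minkowski inequality
    applies to their finite parts. *)
Lemma ge0_Lnorm_leD (r : R) f g h : 1 <= r ->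
  measurable_fun setT f -> measurable_fun setT g -> measurable_fun setT h ->
  (forall x, 0 <= f x)%E -> (forall x, 0 <= g x)%E -> (forall x, 0 <= h x)%E ->
  (forall x, f x <= g x + h x)%E ->
  (Lnorm mu r%:E f <= Lnorm mu r%:E g + Lnorm mu r%:E h)%E.
Proof.
move=> r1 mf mg mh f0 g0 h0 fgh.
have r0 : 0 < r by exact: lt_le_trans r1.
have [->|goo] := eqVneq (Lnorm mu r%:E g) +oo%E.
  by rewrite addye ?leey// gt_eqF// (lt_le_trans _ (Lnorm_ge0 _ _ _))// ltNy0.
have [->|hoo] := eqVneq (Lnorm mu r%:E h) +oo%E.
  by rewrite addey ?leey// gt_eqF// (lt_le_trans _ (Lnorm_ge0 _ _ _))// ltNy0.
have gfin := ge0_Lnorm_lty_ae r0 mg g0 _.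
have hfin := ge0_Lnorm_lty_ae r0 mh h0 _.
have mfine k : measurable_fun setT k -> measurable_fun setT (fine \o k).
  by move=> mk; apply: (measurable_comp _ _ (fine_measurable measurableT) mk).
apply: (@le_trans _ _ (Lnorm mu r%:E (EFin \o ((fine \o g) \+ (fine \o h))%R))).
  apply: ae_ge0_le_Lnorm => //.
  - by apply/measurable_EFinP/measurable_funD; exact: mfine.
  - by move=> x; rewrite lee_fin addr_ge0// fine_ge0.
  have {}gfin := gfin (ltac:(by rewrite ltey)).
  have {}hfin := hfin (ltac:(by rewrite ltey)).
  apply: filterS2 gfin hfin => x gx hx.
  by rewrite /= EFinD !fineK.
apply: (le_trans (minkowski_EFin _ _ _ _)) => //; [exact: mfine|exact: mfine|].
(* [fine] sends [+oo] to 0, so passing to finite parts can only lower the norm. *)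
have fineL k : measurable_fun setT k -> (forall x, 0 <= k x)%E ->
    (Lnorm mu r%:E (EFin \o (fine \o k)) <= Lnorm mu r%:E k)%E.
  move=> mk k0; apply: ge0_le_Lnorm => //.
  - exact/measurable_EFinP/mfine.
  - by move=> x; rewrite lee_fin fine_ge0.
  - move=> x /=; have := k0 x; case: (k x) => //= _; exact: leey.
by apply: leeD; exact: fineL.
Qed.

Lemma ge0_Lnorm_sqr (r : R) f : 0 < r -> (forall x, 0 <= f x)%E ->
  (Lnorm mu r%:E f `^ 2 = Lnorm mu (r / 2)%:E (fun x => f x `^ 2))%E.
Proof.
move=> r0 f0; rewrite unlock -poweRrM invf_div mulrC; congr (_ `^ _)%E.
apply: eq_integral => x _; rewrite !gee0_abs ?poweR_ge0// -poweRrM.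
by rewrite mulrC divfK.
Qed.

(** The square of the $L^r$ norm is the $L^{r/2}$ norm of the square, and [2 <= r] is what makes
    $r/2$ an exponent for which the triangle inequality holds. *)
Lemma ge0_Lnorm_le_sqrD (r : R) f g h : 2 <= r ->
  measurable_fun setT f -> measurable_fun setT g -> measurable_fun setT h ->
  (forall x, 0 <= f x)%E -> (forall x, 0 <= g x)%E -> (forall x, 0 <= h x)%E ->
  (forall x, f x `^ 2 <= g x `^ 2 + h x `^ 2)%E ->
  (Lnorm mu r%:E f `^ 2 <= Lnorm mu r%:E g `^ 2 + Lnorm mu r%:E h `^ 2)%E.
Proof.
move=> r2 mf mg mh f0 g0 h0 fgh.
have r0 : 0 < r by apply: lt_le_trans r2.
rewrite !ge0_Lnorm_sqr//; apply: ge0_Lnorm_leD => //.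
- by rewrite ler_pdivlMr// mul1r.
all: by [exact: ge0_measurable_poweR|move=> x; exact: poweR_ge0].
Qed.

End Lnorm_facts.

Local Notation normc := ComplexField.Normc.normc.

(** * Real and imaginary parts, conjugation and modulus *)

Section complex_numbers.
Context {R : realType}.
Implicit Types x y : R[i].

Lemma RecD x y : complex.Re (x + y) = complex.Re x + complex.Re y.
Proof. by case: x; case: y. Qed.

Lemma ImcD x y : complex.Im (x + y) = complex.Im x + complex.Im y.
Proof. by case: x; case: y. Qed.

Lemma RecM x y :
  complex.Re (x * y) = complex.Re x * complex.Re y - complex.Im x * complex.Im y.
Proof. by case: x; case: y. Qed.

Lemma ImcM x y :
  complex.Im (x * y) = complex.Re x * complex.Im y + complex.Im x * complex.Re y.
Proof. by case: x => a b; case: y => c e. Qed.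

Lemma Re_conjc x : complex.Re (conjc x) = complex.Re x.
Proof. by case: x. Qed.

Lemma Im_conjc x : complex.Im (conjc x) = - complex.Im x.
Proof. by case: x. Qed.

Lemma conjcM x y : conjc (x * y) = conjc x * conjc y.
Proof. exact: rmorphM. Qed.

Lemma normc_ge0 x : 0 <= normc x.
Proof. by case: x => a b; exact: sqrtr_ge0. Qed.

Lemma normcE2 x : normc x = Num.sqrt (complex.Re x ^+ 2 + complex.Im x ^+ 2).
Proof. by case: x. Qed.

Lemma sqr_normc x : normc x ^+ 2 = complex.Re x ^+ 2 + complex.Im x ^+ 2.
Proof. by rewrite normcE2 sqr_sqrtr// addr_ge0// sqr_ge0. Qed.

Lemma normc_real (a : R) : normc a%:C = `|a|.
Proof. by rewrite normcE2 /= expr0n/= addr0 sqrtr_sqr. Qed.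

Lemma normc_conj x : normc (conjc x) = normc x.
Proof. by rewrite !normcE2 Re_conjc Im_conjc sqrrN. Qed.

Lemma normr_Re_le x : `|complex.Re x| <= normc x.
Proof. by rewrite normcE2 -sqrtr_sqr ler_sqrt ?lerDl ?addr_ge0 ?sqr_ge0. Qed.

Lemma normr_Im_le x : `|complex.Im x| <= normc x.
Proof. by rewrite normcE2 -sqrtr_sqr ler_sqrt ?lerDr ?addr_ge0 ?sqr_ge0. Qed.

Lemma expi_conj (a : R) : conjc (expi a) = expi (- a).
Proof. by rewrite /expi/= cosN sinN. Qed.

Lemma normc_expi (a : R) : normc (expi a) = 1.
Proof. by rewrite normcE2/= cos2Dsin2 sqrtr1. Qed.

End complex_numbers.

(** * Measurability, integrals and norms of complex-valued functions *)

Section complex_functions.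
Context {d : measure_display} {T : measurableType d} {R : realType}.
Variable mu : {measure set T -> \bar R}.
Implicit Types (f g : T -> R[i]) (a b : R[i]) (D : set T).

Lemma cmeasurable_cst a : cmeasurable (fun _ : T => a).
Proof. by split; exact: measurable_cst. Qed.

Lemma cmeasurableD f g : cmeasurable f -> cmeasurable g ->
  cmeasurable (fun x => f x + g x).
Proof.
move=> [f1 f2] [g1 g2]; split.
- by under eq_fun do rewrite RecD; exact: measurable_funD.
- by under eq_fun do rewrite ImcD; exact: measurable_funD.
Qed.

Lemma cmeasurableM f g : cmeasurable f -> cmeasurable g ->
  cmeasurable (fun x => f x * g x).
Proof.
move=> [f1 f2] [g1 g2]; split.
- by under eq_fun do rewrite RecM; apply: measurable_funB; exact: measurable_funM.
- by under eq_fun do rewrite ImcM; apply: measurable_funD; exact: measurable_funM.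
Qed.

Lemma cmeasurable_lin a b f g : cmeasurable f -> cmeasurable g ->
  cmeasurable (fun x => a * f x + b * g x).
Proof.
by move=> mf mg; apply: cmeasurableD; apply: cmeasurableM => //;
  exact: cmeasurable_cst.
Qed.

Lemma cmeasurable_conj f : cmeasurable f -> cmeasurable (fun x => conjc (f x)).
Proof.
move=> [f1 f2]; split.
- by under eq_fun do rewrite Re_conjc.
- by under eq_fun do rewrite Im_conjc; exact: measurableT_comp.
Qed.

Lemma cmeasurable_real (f : T -> R) : measurable_fun setT f ->
  cmeasurable (fun x => (f x)%:C).
Proof. by move=> mf; split => //=; exact: measurable_cst. Qed.

Lemma cmeasurable_normc f : cmeasurable f ->
  measurable_fun setT (fun x => normc (f x)).
Proof.
move=> [f1 f2]; under eq_fun do rewrite normcE2.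
apply: measurableT_comp.
  by apply: continuous_measurable_fun; exact: sqrt_continuous.
by apply: measurable_funD; exact: measurable_funX.
Qed.

Lemma cintegrable_lin D a b f g : measurable D ->
  cintegrable mu D f -> cintegrable mu D g ->
  cintegrable mu D (fun x => a * f x + b * g x).
Proof.
move=> mD [f1 f2] [g1 g2].
have Z (k : R) (h : T -> R) : mu.-integrable D (fun x => (h x)%:E) ->
    mu.-integrable D (fun x => (k * h x)%:E).
  by move=> ih; under eq_fun do rewrite EFinM; exact: integrableZl.
split.
- under eq_fun do rewrite RecD !RecM EFinD !EFinB.
  by apply: integrableD => //; apply: integrableB => //; exact: Z.
- under eq_fun do rewrite ImcD !ImcM !EFinD.
  by apply: integrableD => //; apply: integrableD => //; exact: Z.
Qed.

Lemma cintegral_lin D a b f g : measurable D ->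
  cintegrable mu D f -> cintegrable mu D g ->
  cintegral mu D (fun x => a * f x + b * g x) =
  a * cintegral mu D f + b * cintegral mu D g.
Proof.
move=> mD [f1 f2] [g1 g2].
have Z (k : R) (h : T -> R) : mu.-integrable D (fun x => (h x)%:E) ->
    mu.-integrable D (fun x => (k * h x)%:E).
  by move=> ih; under eq_fun do rewrite EFinM; exact: integrableZl.
have A (h k : T -> R) : mu.-integrable D (fun x => (h x)%:E) ->
    mu.-integrable D (fun x => (k x)%:E) ->
    mu.-integrable D (fun x => (h x + k x)%:E).
  by move=> ih ik; under eq_fun do rewrite EFinD; exact: integrableD.
have B (h k : T -> R) : mu.-integrable D (fun x => (h x)%:E) ->
    mu.-integrable D (fun x => (k x)%:E) ->
    mu.-integrable D (fun x => (h x - k x)%:E).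
  by move=> ih ik; under eq_fun do rewrite EFinB; exact: integrableB.
apply/eqP; rewrite eq_complex /cintegral RecD ImcD !RecM !ImcM/=; apply/andP; split.
- under eq_Rintegral do rewrite RecD !RecM.
  rewrite RintegralD// ?RintegralB ?RintegralZl//; try exact: Z.
  + by apply: B; exact: Z.
  + by apply: B; exact: Z.
- under eq_Rintegral do rewrite ImcD !ImcM.
  rewrite RintegralD// ?RintegralD ?RintegralZl//; try exact: Z.
  + by apply: A; exact: Z.
  + by apply: A; exact: Z.
Qed.

Lemma cintegrable_conj D f : measurable D ->
  cintegrable mu D f -> cintegrable mu D (fun x => conjc (f x)).
Proof.
move=> mD [f1 f2]; split.
- by under eq_fun do rewrite Re_conjc.
- by under eq_fun do rewrite Im_conjc EFinN; exact: integrableN.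
Qed.

(* When both the positive and the negative part have infinite integral, both
   sides are 0. *)
Lemma RintegralN D (f : T -> R) :
  Rintegral mu D (fun x => - f x) = - Rintegral mu D f.
Proof.
rewrite /Rintegral; under eq_integral do rewrite EFinN.
have [h|] := boolP ((\int[mu]_(x in D) (EFin \o f)^\+ x) +?
    (- (\int[mu]_(x in D) (EFin \o f)^\- x)))%E.
  by rewrite integralN// fineN.
rewrite /adde_def negb_and !negbK => /orP[/andP[/eqP p /eqP n]|/andP[/eqP p _]].
  rewrite [in LHS]integralE [in RHS]integralE.
  rewrite (funeposN (EFin \o f)) (funenegN (EFin \o f)) p.
  by move/eqP: n; rewrite eqe_oppLR/= => /eqP ->; rewrite /= oppr0.
have : (0 <= \int[mu]_(x in D) (EFin \o f)^\+ x)%E by exact: integral_ge0.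
by rewrite p.
Qed.

Lemma cintegral_conj D f :
  cintegral mu D (fun x => conjc (f x)) = conjc (cintegral mu D f).
Proof.
rewrite /cintegral/=; congr Complex.
- by apply: eq_Rintegral => x _; rewrite Re_conjc.
- by rewrite -RintegralN; apply: eq_Rintegral => x _; rewrite Im_conjc.
Qed.

Lemma ge0_LnormZ (r k : R) (f : T -> \bar R) : 0 < r -> 0 <= k ->
  measurable_fun setT f -> (forall x, 0 <= f x)%E ->
  Lnorm mu r%:E (fun x => k%:E * f x)%E = (k%:E * Lnorm mu r%:E f)%E.
Proof.
move=> r0 k0 mf f0; rewrite unlock.
under eq_integral => x _.
  rewrite gee0_abs ?mule_ge0// poweRM//.
  over.
rewrite ge0_integralZl//; last first.
- exact: poweR_ge0.
- by move=> x _; exact: poweR_ge0.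
- exact: ge0_measurable_poweR.
rewrite poweRM ?poweR_ge0//; last first.
  by apply: integral_ge0 => x _; exact: poweR_ge0.
rewrite -poweRrM mulfV ?gt_eqF// poweRe1//; congr (_ * _ `^ _)%E.
by apply: eq_integral => x _; rewrite gee0_abs.
Qed.

Lemma cLnorm_lin (r : R) a b f g : 1 <= r -> cmeasurable f -> cmeasurable g ->
  (cLnorm mu r (fun x => a * f x + b * g x)%R <=
   (normc a)%:E * cLnorm mu r f + (normc b)%:E * cLnorm mu r g)%E.
Proof.
move=> r1 mf mg; have r0 : 0 < r by exact: lt_le_trans r1.
have nm (h : T -> R[i]) : cmeasurable h -> measurable_fun setT (fun x => (normc (h x))%:E).
  by move=> mh; apply/measurable_EFinP; exact: cmeasurable_normc.
rewrite /cLnorm -!ge0_LnormZ ?normc_ge0//; try exact: nm;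
  try (by move=> x; rewrite lee_fin normc_ge0).
apply: ge0_Lnorm_leD => //.
- by apply: nm; exact: cmeasurable_lin.
- by apply: measurable_funeM; exact: nm.
- by apply: measurable_funeM; exact: nm.
- by move=> x; rewrite lee_fin normc_ge0.
- by move=> x; rewrite -EFinM lee_fin mulr_ge0// normc_ge0.
- by move=> x; rewrite -EFinM lee_fin mulr_ge0// normc_ge0.
- move=> x; rewrite -!EFinM -EFinD lee_fin.
  by rewrite (le_trans (le_normcD _ _))// !ComplexField.Normc.normcM.
Qed.

Lemma cLnorm_conj (r : R) f : cLnorm mu r (fun x => conjc (f x)) = cLnorm mu r f.
Proof. by apply: eq_Lnorm => x; rewrite normc_conj. Qed.

Lemma sqr_cLnorm2 f :
  (cLnorm mu 2 f `^ 2 = \int[mu]_x (normc (f x) ^+ 2)%:E)%E.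
Proof.
rewrite poweR_Lnorm ?pnatr_eq0//; apply: eq_integral => x _.
rewrite gee0_abs ?lee_fin ?normc_ge0//= powR_mulrn//.
exact: normc_ge0.
Qed.

End complex_functions.

(** * Invariance of Lebesgue integrals under $x\mapsto -x$ *)

Section reflection.
Context {R : realType}.
Local Notation leb := (@lebesgue_measure R).

Lemma ge0_integral_reflect (f : R -> \bar R) :
  measurable_fun setT f -> (forall x, 0 <= f x)%E ->
  (\int[leb]_x f (- x)%R = \int[leb]_x f x)%E.
Proof.
move=> mf f0.
(* Writing the domain as a preimage under negation exhibits an integral against the pushforward
   measure, which is Lebesgue measure again. *)
have -> : (\int[leb]_x f (- x)%R)%E =
    (\int[leb]_(x in (-%R : _ -> measurableTypeR R) @^-1` setT)
      (f \o (-%R : _ -> measurableTypeR R)) x)%E by [].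
rewrite -ge0_integral_pushforward//.
by apply: eq_measure_integral => //= A mA _; exact: lebesgue_measureN.
Qed.

Lemma integral_reflect (f : R -> \bar R) : measurable_fun setT f ->
  (\int[leb]_x f (- x)%R = \int[leb]_x f x)%E.
Proof.
move=> mf; rewrite [LHS]integralE [RHS]integralE; congr (_ - _)%E.
- rewrite -(ge0_integral_reflect (measurable_funepos mf))//.
  by apply: eq_integral => x _; rewrite !funeposE.
- rewrite -(ge0_integral_reflect (measurable_funeneg mf))//.
  by apply: eq_integral => x _; rewrite !funenegE.
Qed.

Lemma measurable_reflect d (U : measurableType d) (f : R -> U) :
  measurable_fun setT (f : measurableTypeR R -> U) ->
  measurable_fun setT ((fun x => f (- x)) : measurableTypeR R -> U).
Proof. by move=> mf; apply: (measurableT_comp mf); exact: oppr_measurable. Qed.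

Lemma integrable_reflect (f : R -> \bar R) :
  leb.-integrable setT f -> leb.-integrable setT (fun x => f (- x)).
Proof.
move=> /integrableP[mf fi]; apply/integrableP; split.
  exact: measurable_reflect.
rewrite (ge0_integral_reflect (f := fun x => `|f x|%E))//.
exact: measurableT_comp.
Qed.

Lemma cmeasurable_reflect (f : R -> R[i]) :
  cmeasurable (f : measurableTypeR R -> R[i]) ->
  cmeasurable ((fun x => f (- x)) : measurableTypeR R -> R[i]).
Proof.
move=> [f1 f2]; split.
- exact: (measurable_reflect f1).
- exact: (measurable_reflect f2).
Qed.

Lemma cintegrable_reflect (f : R -> R[i]) :
  cintegrable leb setT f -> cintegrable leb setT (fun x => f (- x)).
Proof.
move=> [f1 f2]; split.
- exact: (integrable_reflect f1).
- exact: (integrable_reflect f2).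
Qed.

Lemma cintegral_reflect (f : R -> R[i]) :
  cmeasurable (f : measurableTypeR R -> R[i]) ->
  cintegral leb setT (fun x => f (- x)) = cintegral leb setT f.
Proof.
move=> [f1 f2]; congr Complex; congr fine.
- apply: (integral_reflect (f := fun x => (complex.Re (f x))%:E)).
  exact/measurable_EFinP.
- apply: (integral_reflect (f := fun x => (complex.Im (f x))%:E)).
  exact/measurable_EFinP.
Qed.

Lemma cLnorm_reflect (r : R) (f : R -> R[i]) :
  cmeasurable (f : measurableTypeR R -> R[i]) ->
  cLnorm leb r (fun x => f (- x)) = cLnorm leb r f.
Proof.
move=> mf; rewrite /cLnorm unlock; apply: (f_equal (fun y => y `^ _)%E).
apply: (ge0_integral_reflect (f := fun x => (`|(normc (f x))%:E| `^ r)%E)).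
  apply: ge0_measurable_poweR; apply: measurableT_comp => //.
  by apply/measurable_EFinP; exact: cmeasurable_normc.
by move=> x; exact: poweR_ge0.
Qed.

End reflection.

(** * Fourier integrals: conjugation, reflection, measurability in the frequency *)

Section fourier.
Context {R : realType}.
Local Notation leb := (@lebesgue_measure R).
Implicit Types (u v w m g phi : R -> R[i]) (D : set R) (a b : R[i]).

Lemma cmeasurable_expi d (T : measurableType d) (h : T -> R) :
  measurable_fun setT h -> cmeasurable (fun x => expi (h x)).
Proof.
move=> mh; split => /=.
- apply: (measurableT_comp (f := @cos R)) => //.
  by apply: continuous_measurable_fun; exact: continuous_cos.
- apply: (measurableT_comp (f := @sin R)) => //.
  by apply: continuous_measurable_fun; exact: continuous_sin.
Qed.

Lemma fourier_integral_conj D u xi :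
  fourier_integral D (fun x => conjc (u x)) xi = conjc (fourier_integral D u (- xi)).
Proof.
rewrite /fourier_integral conjcM. rewrite conjc_real -cintegral_conj; congr (_ * _).
congr cintegral; apply/funext => x.
by rewrite conjcM expi_conj mulrN !opprK.
Qed.

Lemma fourier_integral_reflect u xi : cmeasurable (u : measurableTypeR R -> R[i]) ->
  fourier_integral setT (fun x => u (- x)) xi = fourier_integral setT u (- xi).
Proof.
move=> mu; rewrite /fourier_integral; congr (_ * _).
rewrite -(cintegral_reflect (f := fun x => u x * expi (- (x * - xi)))).
  by congr cintegral; apply/funext => x; rewrite mulrNN.
apply: cmeasurableM => //; apply: cmeasurable_expi.
by apply: measurableT_comp => //; exact: measurable_funM.
Qed.

(** Tonelli's theorem makes the partial integrals of the positive and negative parts of the kernel,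
    cut off by [\1_D], measurable in [xi]; the integral is [fine] of their difference. The triangle
    inequality for the truncation errors in [is_fourier_lin] relies on this measurability. *)
Lemma measurable_Rintegral_param D (k : R * R -> R) : measurable D ->
  measurable_fun setT (k : measurableTypeR R * measurableTypeR R -> R) ->
  measurable_fun setT
    ((fun xi => Rintegral leb D (fun x => k (x, xi))) : measurableTypeR R -> R).
Proof.
move=> mD mk.
pose K (z : measurableTypeR R * measurableTypeR R) := (k z * \1_D z.1)%:E.
have mK : measurable_fun setT K.
  apply/measurable_EFinP; apply: measurable_funM => //.
  by apply: (measurableT_comp (measurable_indic mD)); exact: measurable_fst.
have -> : (fun xi => Rintegral leb D (fun x => k (x, xi))) =
    fun xi => fine (fubini_G leb (K^\+)%E xi - fubini_G leb (K^\-)%E xi)%E.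
  apply/funext => xi; rewrite /Rintegral integral_mkcond integralE.
  congr (fine (_ - _)%E); apply: eq_integral => x _;
  by rewrite ?funeposE ?funenegE /K patchE indicE/=;
    case: (x \in D); rewrite ?mulr1 ?mulr0.
apply: (measurable_comp _ _ (fine_measurable measurableT)) => //.
apply: emeasurable_funB.
- by apply: measurable_fun_fubini_tonelli_G => //; exact: measurable_funepos.
- by apply: measurable_fun_fubini_tonelli_G => //; exact: measurable_funeneg.
Qed.

Lemma cmeasurable_fourier_integral D u : measurable D ->
  cmeasurable (u : measurableTypeR R -> R[i]) ->
  cmeasurable (fourier_integral D u : measurableTypeR R -> R[i]).
Proof.
move=> mD mu; apply: cmeasurableM; first exact: cmeasurable_cst.
pose k (z : measurableTypeR R * measurableTypeR R) := u z.1 * expi (- (z.1 * z.2)).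
have [k1 k2] : cmeasurable k.
  apply: cmeasurableM.
    case: mu => u1 u2; split.
    - exact: (measurableT_comp u1 measurable_fst).
    - exact: (measurableT_comp u2 measurable_fst).
  apply: cmeasurable_expi; apply: measurableT_comp => //.
  by apply: measurable_funM; [exact: measurable_fst|exact: measurable_snd].
split.
- exact: (measurable_Rintegral_param mD k1).
- exact: (measurable_Rintegral_param mD k2).
Qed.

End fourier.

(** * Stability of Schwartz functions under $\phi\mapsto\overline{\phi(-\,\cdot)}$ *)

Section schwartz_conjugation.
Context {R : realType}.
Implicit Types (f : R -> R) (phi : R -> R[i]).

Lemma is_derive1_scale_reflect f (c x : R) : derivable f (- x) 1 ->
  is_derive x 1 (fun y => c * f (- y)) (- c * derive1 f (- x)).
Proof.
move=> df; have H : is_derive (- x) 1 f (derive1 f (- x)).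
  by rewrite derive1E; exact: DeriveDef.
have := is_deriveZ c (is_derive1_comp H (is_deriveNid x 1)).
by rewrite mulrN1 scalerN -scaleNr.
Qed.

Lemma derive1n_scale_reflect f (c : R) :
  (forall n x, derivable (derive1n n f) x 1) ->
  forall n, derive1n n (fun x => c * f (- x)) =
            (fun x => c * (-1) ^+ n * derive1n n f (- x)).
Proof.
move=> df; elim=> [|n ih]; first by apply/funext => x; rewrite expr0 mulr1.
rewrite derive1nS ih; apply/funext => x; rewrite derive1E.
have [_ ->] := is_derive1_scale_reflect (c * (-1) ^+ n) (df n (- x)).
by rewrite derive1nS exprS mulN1r mulrN.
Qed.

(** The factor [c] treats both parts of $\overline{\phi(-x)}$ at once: it is 1 for the real part and
    -1 for the imaginary part. Each derivative only contributes a sign, so decay constants are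
    multiplied by $|c|$. *)
Lemma real_schwartz_scale_reflect f (c : R) : real_schwartz f ->
  real_schwartz (fun x => c * f (- x)).
Proof.
move=> sf; have df n x := (sf n).1 x.
move=> n; rewrite derive1n_scale_reflect//; split=> [x|m].
  by have [] := is_derive1_scale_reflect (c * (-1) ^+ n) (df n (- x)).
have [C hC] := (sf n).2 m; exists (`|c| * C) => x.
rewrite !normrM normrX normrN1 expr1n mulr1 mulrCA ler_wpM2l//.
by rewrite -[in `|x|]normrN.
Qed.

Lemma real_schwartz_measurable f : real_schwartz f ->
  measurable_fun setT (f : measurableTypeR R -> R).
Proof.
move=> sf; apply: continuous_measurable_fun => x.
by apply: differentiable_continuous; apply/derivable1_diffP; exact: ((sf 0).1 x).
Qed.

Lemma schwartz_cmeasurable phi : schwartz phi ->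
  cmeasurable (phi : measurableTypeR R -> R[i]).
Proof. by move=> [s1 s2]; split; exact: real_schwartz_measurable. Qed.

Lemma schwartz_conj_reflect phi : schwartz phi ->
  schwartz (fun x => conjc (phi (- x))).
Proof.
move=> [s1 s2]; split.
- under eq_fun do rewrite Re_conjc -[complex.Re _]mul1r.
  exact: (real_schwartz_scale_reflect _ s1).
- under eq_fun do rewrite Im_conjc -mulN1r.
  exact: (real_schwartz_scale_reflect _ s2).
Qed.

End schwartz_conjugation.

(** * Linearity and conjugation for the Fourier-Plancherel transform *)

Section airy_symmetries.
Context {R : realType}.
Local Notation leb := (@lebesgue_measure R).
Implicit Types (u v w m g phi : R -> R[i]) (F G : R * R -> R[i]) (a b : R[i]).

Lemma L2_lin a b u v : L2 u -> L2 v -> L2 (fun x => a * u x + b * v x).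
Proof.
move=> [mu u2] [mv v2]; split; first exact: cmeasurable_lin.
apply: (le_lt_trans (cLnorm_lin _ _ _ _ mu mv)); first by rewrite ler1n.
have fin k (h : R -> R[i]) : (L2norm h < +oo)%E ->
    ((normc k)%:E * cLnorm leb 2 h < +oo)%E.
  move=> hoo; rewrite lte_mul_pinfty// ?lee_fin ?normc_ge0//.
by rewrite lte_add_pinfty// fin.
Qed.

(** The exponential has modulus 1 and $|u|\le 1+|u|^2$, which is integrable on a bounded
    interval. *)
Lemma L2_integrable_itv u (h : R -> R) (n : nat) : L2 u ->
  measurable_fun setT (h : measurableTypeR R -> R) ->
  cintegrable leb `[- n%:R, n%:R] (fun x => u x * expi (h x)).
Proof.
move=> [mu u2] mh; set I := `[_, _]%classic.
have mI : measurable I by exact: measurable_itv.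
have [m1 m2] : cmeasurable ((fun x => u x * expi (h x)) : measurableTypeR R -> R[i]).
  by apply: cmeasurableM => //; exact: cmeasurable_expi.
have iN : leb.-integrable setT (fun x => (normc (u x) ^+ 2)%:E).
  apply/integrableP; split.
    by apply/measurable_EFinP; apply: measurable_funX; exact: cmeasurable_normc.
  under eq_integral do rewrite gee0_abs ?lee_fin ?sqr_ge0//.
  by rewrite -sqr_cLnorm2 poweR_lty.
have i1 : leb.-integrable I (fun x => (1 + normc (u x) ^+ 2)%:E).
  under eq_fun do rewrite EFinD; apply: integrableD => //.
    apply/integrableP; split; first exact: measurable_cst.
    under eq_integral do rewrite gee0_abs ?lee01//.
    rewrite integral_cst//= mul1e lebesgue_measure_itv/=.
    by case: ifPn => // _; rewrite ltry.
  exact: (integrableS measurableT).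
have b x : normc (u x * expi (h x)) <= `|1 + normc (u x) ^+ 2|.
  rewrite ComplexField.Normc.normcM normc_expi mulr1 ger0_norm; last first.
    by rewrite addr_ge0// sqr_ge0.
  (* $(s-\frac12)^2\ge0$ gives $s\le s^2+\frac14\le 1+s^2$. *)
  have := sqr_ge0 (normc (u x) - 2^-1); nra.
split; apply: (le_integrable _ _ _ i1) => //.
- by apply/measurable_EFinP; exact: measurable_funTS.
- by move=> x _; rewrite lee_fin (le_trans (normr_Re_le _)).
- by apply/measurable_EFinP; exact: measurable_funTS.
- by move=> x _; rewrite lee_fin (le_trans (normr_Im_le _)).
Qed.

Lemma fourier_integral_lin a b u w (n : nat) (xi : R) : L2 u -> L2 w ->
  fourier_integral `[- n%:R, n%:R] (fun x => a * u x + b * w x) xi =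
  a * fourier_integral `[- n%:R, n%:R] u xi +
  b * fourier_integral `[- n%:R, n%:R] w xi.
Proof.
move=> Lu Lw; have mh : measurable_fun setT
    ((fun x => - (x * xi)) : measurableTypeR R -> R).
  by apply: measurableT_comp => //; exact: measurable_funM.
have iu := L2_integrable_itv n Lu mh; have iw := L2_integrable_itv n Lw mh.
rewrite /fourier_integral (_ : (fun x => _ * expi _) = (fun x =>
    a * (u x * expi (- (x * xi))) + b * (w x * expi (- (x * xi))))); last first.
  by apply/funext => x; rewrite mulrDl !mulrA.
by rewrite cintegral_lin//; ring.
Qed.

Lemma is_fourier_lin a b u w v1 v2 : L2 u -> L2 w ->
  is_fourier u v1 -> is_fourier w v2 ->
  is_fourier (fun x => a * u x + b * w x) (fun xi => a * v1 xi + b * v2 xi).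
Proof.
move=> Lu Lw [Lv1 c1] [Lv2 c2]; split; first exact: L2_lin.
pose N f g (n : nat) :=
  L2norm (fun xi => g xi - fourier_integral `[- n%:R, n%:R] f xi).
have md (f g : R -> R[i]) (n : nat) : L2 f -> L2 g -> cmeasurable ((fun xi =>
    g xi - fourier_integral `[- n%:R, n%:R] f xi) : measurableTypeR R -> R[i]).
  move=> [mf _] [mg _].
  have := cmeasurable_lin 1 (-1) mg
    (cmeasurable_fourier_integral (D := `[- n%:R, n%:R]) (measurable_itv _) mf).
  by under eq_fun do rewrite mul1r mulN1r.
apply: (@squeeze_cvge _ _ _ _ (cst 0%E) _
   (fun n => ((normc a)%:E * N u v1 n + (normc b)%:E * N w v2 n)%E)).
- apply: nearW => n; rewrite Lnorm_ge0/=.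
  have le12 : 1 <= 2 :> R by rewrite ler1n.
  apply: (le_trans _ (cLnorm_lin leb a b le12 (md _ _ n Lu Lv1) (md _ _ n Lw Lv2))).
  rewrite le_eqVlt; apply/orP; left; apply/eqP; congr (cLnorm _ _ _).
  by apply/funext => xi; rewrite fourier_integral_lin//; ring.
- exact: cvg_cst.
- rewrite [X in _ --> X](_ : _ = ((normc a)%:E * 0 + (normc b)%:E * 0)%E); last first.
    by rewrite !mule0 adde0.
  apply: cvgeD; first by rewrite !mule0.
  + exact: (cvgeZl (y := (normc a)%:E) _ c1).
  + exact: (cvgeZl (y := (normc b)%:E) _ c2).
Qed.

(** The truncation error of the conjugate at $\xi$ is the conjugate of the error of [u] at $-\xi$.
    Both operations preserve the norm, so the two sequences of errors coincide term by term. *)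
Lemma is_fourier_conj u v : L2 u -> is_fourier u v ->
  is_fourier (fun x => conjc (u x)) (fun xi => conjc (v (- xi))).
Proof.
move=> [mu _] [[mv Lv] c]; split.
  split; first by apply: cmeasurable_conj; exact: cmeasurable_reflect.
  by rewrite /L2norm cLnorm_conj cLnorm_reflect.
rewrite (_ : (fun n : nat => _) =
  (fun n : nat => L2norm (fun xi => v xi - fourier_integral `[- n%:R, n%:R] u xi)))//.
apply/funext => n; rewrite /L2norm -[RHS]cLnorm_conj -[RHS]cLnorm_reflect.
  congr (cLnorm _ _ _); apply/funext => xi.
  by rewrite fourier_integral_conj rmorphB.
apply: cmeasurable_conj.
have := cmeasurable_lin 1 (-1) mv
  (cmeasurable_fourier_integral (D := `[- n%:R, n%:R]) (measurable_itv _) mu).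
by under eq_fun do rewrite mul1r mulN1r.
Qed.

End airy_symmetries.

(** * Representatives of the evolution: linearity, conjugation, real parts, the zero class *)

Section airy_representatives.
Context {R : realType}.
Local Notation leb := (@lebesgue_measure R).
Implicit Types (u v w m g phi : R -> R[i]) (F G : R * R -> R[i]) (a b : R[i]).

Lemma cintegrable_cmeasurable u : cintegrable leb setT u ->
  cmeasurable (u : measurableTypeR R -> R[i]).
Proof.
by move=> [/integrableP[m1 _] /integrableP[m2 _]]; split; exact/measurable_EFinP.
Qed.

Lemma is_inverse_fourier_lin a b m1 m2 g1 g2 :
  is_inverse_fourier m1 g1 -> is_inverse_fourier m2 g2 ->
  is_inverse_fourier (fun xi => a * m1 xi + b * m2 xi)
                     (fun x => a * g1 x + b * g2 x).
Proof.
move=> H1 H2 phi sphi; have [i1 j1 e1] := H1 _ sphi; have [i2 j2 e2] := H2 _ sphi.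
have distr (f1 f2 h : R -> R[i]) : (fun x => (a * f1 x + b * f2 x) * h x) =
    (fun x => a * (f1 x * h x) + b * (f2 x * h x)).
  by apply/funext => x; rewrite mulrDl !mulrA.
rewrite !distr; split; [exact: cintegrable_lin|exact: cintegrable_lin|].
by rewrite !cintegral_lin// e1 e2.
Qed.

(** The hypothesis is tested on $\psi(x)=\overline{\phi(-x)}$, chosen because
    $\hat\psi=\overline{\hat\phi}$. Conjugating the resulting identity and reflecting the frequency
    integral gives the claim for $\phi$. *)
Lemma is_inverse_fourier_conj m g : is_inverse_fourier m g ->
  is_inverse_fourier (fun xi => conjc (m (- xi))) (fun x => conjc (g x)).
Proof.
move=> H phi sphi; pose psi := fun x => conjc (phi (- x)).
have [i j e] := H _ (schwartz_conj_reflect sphi : schwartz psi).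
have Epsi x : fourier_integral setT psi x = conjc (fourier_integral setT phi x).
  rewrite fourier_integral_conj fourier_integral_reflect ?opprK//.
  exact: schwartz_cmeasurable.
have Em : (fun xi => conjc (m (- xi)) * phi xi) =
    (fun xi => conjc (m (- xi) * psi (- xi))).
  by apply/funext => xi; rewrite conjcM /psi opprK conjcK.
have Eg : (fun x => conjc (g x) * fourier_integral setT phi x) =
    (fun x => conjc (g x * fourier_integral setT psi x)).
  by apply/funext => x; rewrite conjcM Epsi conjcK.
rewrite Em Eg; split.
- by apply: cintegrable_conj => //; exact: (cintegrable_reflect i).
- exact: cintegrable_conj.
- rewrite !cintegral_conj e; congr conjc.
  by rewrite -[LHS]cintegral_reflect//; exact: cintegrable_cmeasurable.
Qed.

(** This symmetry is all that the argument takes from the particular form of the multiplier. *)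
Lemma airy_multiplier_conj (gamma t xi : R) :
  conjc (airy_multiplier gamma t (- xi)) = airy_multiplier gamma t xi.
Proof.
rewrite /airy_multiplier conjcM conjc_real expi_conj normrN.
by congr (_ * expi _); ring.
Qed.

Lemma is_airy_lin (gamma : R) a b u w F G : L2 u -> L2 w ->
  is_airy gamma u F -> is_airy gamma w G ->
  is_airy gamma (fun x => a * u x + b * w x) (fun z => a * F z + b * G z).
Proof.
move=> Lu Lw [mF [v fv hF]] [mG [v' fv' hG]].
split; first exact: cmeasurable_lin.
exists (fun xi => a * v xi + b * v' xi); first exact: is_fourier_lin.
move: hF hG; apply: (filterS2 (ae_filter_ringOfSetsType leb)) => t h1 h2.
rewrite (_ : (fun xi => _) = (fun xi => a * (airy_multiplier gamma t xi * v xi) +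
    b * (airy_multiplier gamma t xi * v' xi))).
  exact: is_inverse_fourier_lin.
by apply/funext => xi; ring.
Qed.

Lemma is_airy_conj (gamma : R) u F : L2 u -> is_airy gamma u F ->
  is_airy gamma (fun x => conjc (u x)) (fun z => conjc (F z)).
Proof.
move=> Lu [mF [v fv hF]]; split; first exact: cmeasurable_conj.
exists (fun xi => conjc (v (- xi))); first exact: is_fourier_conj.
move: hF; apply: (@filterS _ _ (ae_filter_ringOfSetsType leb)) => t h.
rewrite (_ : (fun xi => _) = (fun xi =>
    conjc (airy_multiplier gamma t (- xi) * v (- xi)))).
  exact: (is_inverse_fourier_conj h).
by apply/funext => xi; rewrite conjcM airy_multiplier_conj.
Qed.

(* F and its conjugate both represent the evolution of the real function u, hence
   so does their mean: no uniqueness of the representing function is needed. *)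
Lemma is_airy_Re (gamma : R) u F : L2 u -> (forall x, complex.Im (u x) = 0) ->
  is_airy gamma u F -> is_airy gamma u (fun z => (complex.Re (F z))%:C).
Proof.
move=> Lu u0 hF.
have Eu : (fun x => conjc (u x)) = u.
  by apply/funext => x; have := u0 x; case: (u x) => c e /= ->; rewrite oppr0.
have hF' := is_airy_conj Lu hF; rewrite Eu in hF'.
have two : (2%:R : R[i]) != 0 by rewrite pnatr_eq0.
have := is_airy_lin (2%:R^-1) (2%:R^-1) Lu Lu hF hF'.
rewrite (_ : (fun x => _ + _) = u); last first.
  by apply/funext => x; rewrite -mulrDl -mulr2n -[_ *+ 2]mulr_natr mulVf// mul1r.
rewrite (_ : (fun z => _ + _) = (fun z => (complex.Re (F z))%:C))//.
by apply/funext => z; rewrite ReJ_add -mulrDr mulrC.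
Qed.

Lemma L2norm_eq0_ae u : cmeasurable (u : measurableTypeR R -> R[i]) ->
  L2norm u = 0%E -> {ae leb, forall x, u x = 0}.
Proof.
move=> mu u0.
have mn : measurable_fun setT
    ((fun x => (normc (u x))%:E) : measurableTypeR R -> \bar R).
  by apply/measurable_EFinP; exact: cmeasurable_normc.
have := Lnorm_eq0_eq0 mn _ u0; move=> /(_ (ltr0n _ 2)).
apply: (@filterS _ _ (ae_filter_ringOfSetsType leb)) => x /(_ I) /= [] h.
exact: ComplexField.Normc.eq0_normc.
Qed.

Lemma fourier_integral_ae0 (D : set R) u xi : measurable D ->
  cmeasurable (u : measurableTypeR R -> R[i]) ->
  {ae leb, forall x, u x = 0} -> fourier_integral D u xi = 0.
Proof.
move=> mD mu u0; rewrite /fourier_integral.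
have [m1 m2] : cmeasurable
    ((fun x => u x * expi (- (x * xi))) : measurableTypeR R -> R[i]).
  apply: cmeasurableM => //; apply: cmeasurable_expi.
  by apply: measurableT_comp => //; exact: measurable_funM.
have I0 (f : R -> R) : measurable_fun setT (f : measurableTypeR R -> R) ->
    {ae leb, forall x, f x = 0} -> Rintegral leb D f = 0.
  move=> mf f0; rewrite /Rintegral (ae_eq_integral (cst 0%E))//.
  - by rewrite integral0.
  - by apply/measurable_EFinP; exact: measurable_funTS.
  - by move: f0; apply: (@filterS _ _ (ae_filter_ringOfSetsType leb)) => x -> .
rewrite /cintegral !I0 ?mulr0//.
- by move: u0; apply: (@filterS _ _ (ae_filter_ringOfSetsType leb)) => x ->; rewrite mul0r.
- by move: u0; apply: (@filterS _ _ (ae_filter_ringOfSetsType leb)) => x ->; rewrite mul0r.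
Qed.

(** Serves the case where the real or the imaginary part of [u] has norm zero: it lies outside
    [L2R_nonzero], so a representative cannot come from a bound on its quotient. *)
Lemma is_airy_ae0 (gamma : R) u : cmeasurable (u : measurableTypeR R -> R[i]) ->
  {ae leb, forall x, u x = 0} -> is_airy gamma u (fun _ => 0).
Proof.
move=> mu u0; split; first exact: cmeasurable_cst.
have L0 : @L2norm R (fun _ => 0) = 0%E.
  rewrite /L2norm /cLnorm ComplexField.Normc.normc0.
  by apply: Lnorm0; rewrite eqe pnatr_eq0.
have I0 : cintegral leb setT (fun _ : R => 0) = 0.
  by rewrite /cintegral/= Rintegral_cst// mul0r.
have J0 : cintegrable leb setT (fun _ : R => 0).
  by split => /=; exact: integrable0.
exists (fun _ => 0); last first.
  apply: aeW => t phi _.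
  rewrite (_ : (fun xi => _ * 0 * _) = fun _ => 0); last first.
    by apply/funext => xi; rewrite mulr0 mul0r.
  rewrite (_ : (fun xi => 0 * _) = fun _ => 0)//.
  by apply/funext => xi; rewrite mul0r.
split; first by split; [exact: cmeasurable_cst|rewrite L0 ltry].
rewrite (_ : (fun n : nat => _) = fun=> 0%E); first exact: cvg_cst.
apply/funext => n; rewrite -[RHS]L0; congr L2norm; apply/funext => xi.
by rewrite fourier_integral_ae0 ?subr0//; exact: measurable_itv.
Qed.

End airy_representatives.

(** * The squared triangle inequality for the mixed norm *)

Section mixed_norm.
Context {R : realType}.
Local Notation leb := (@lebesgue_measure R).
Implicit Types F G : R * R -> R[i].

Lemma mixed_norm_ge0 (p q : R) F : (0 <= mixed_norm p q F)%E.
Proof. exact: Lnorm_ge0. Qed.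

Lemma mixed_norm0 (p q : R) : p != 0 -> q != 0 ->
  @mixed_norm R p q (fun _ => 0) = 0%E.
Proof.
move=> p0 q0; rewrite /mixed_norm /cLnorm ComplexField.Normc.normc0.
by rewrite Lnorm0 ?eqe// Lnorm0.
Qed.

Lemma measurable_cLnorm_section (q : R) F :
  cmeasurable (F : measurableTypeR R * measurableTypeR R -> R[i]) ->
  measurable_fun setT ((fun t => cLnorm leb q (fun x => F (t, x))) :
    measurableTypeR R -> \bar R).
Proof.
move=> mF; rewrite /cLnorm unlock; apply: ge0_measurable_poweR.
pose K (z : measurableTypeR R * measurableTypeR R) :=
  (`|(normc (F z))%:E| `^ q)%E.
apply: (measurable_fun_fubini_tonelli_F K) => [|z].
  apply: ge0_measurable_poweR; apply: measurableT_comp => //.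
  by apply/measurable_EFinP; exact: cmeasurable_normc.
exact: poweR_ge0.
Qed.

Lemma cmeasurable_section F (t : R) :
  cmeasurable (F : measurableTypeR R * measurableTypeR R -> R[i]) ->
  cmeasurable ((fun x => F (t, x)) : measurableTypeR R -> R[i]).
Proof.
move=> [m1 m2]; split.
- exact: (measurable_fun_pair2 t m1).
- exact: (measurable_fun_pair2 t m2).
Qed.

(** [ge0_Lnorm_le_sqrD] is used twice: with exponent [q] in $x$ at each fixed $t$, which supplies
    the pointwise hypothesis for its use with exponent [p] in $t$. *)
Lemma mixed_norm_le_sqrD (p q : R) F F1 F2 : 2 <= p -> 2 <= q ->
  cmeasurable (F : measurableTypeR R * measurableTypeR R -> R[i]) ->
  cmeasurable (F1 : measurableTypeR R * measurableTypeR R -> R[i]) ->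
  cmeasurable (F2 : measurableTypeR R * measurableTypeR R -> R[i]) ->
  (forall z, normc (F z) ^+ 2 <= normc (F1 z) ^+ 2 + normc (F2 z) ^+ 2) ->
  (mixed_norm p q F `^ 2 <= mixed_norm p q F1 `^ 2 + mixed_norm p q F2 `^ 2)%E.
Proof.
move=> p2 q2 mF m1 m2 le12.
apply: ge0_Lnorm_le_sqrD => //; try exact: measurable_cLnorm_section;
  try (move=> t; exact: Lnorm_ge0).
have ms (G : R * R -> R[i]) t :
    cmeasurable (G : measurableTypeR R * measurableTypeR R -> R[i]) ->
    measurable_fun setT
      ((fun x => (normc (G (t, x)))%:E) : measurableTypeR R -> \bar R).
  move=> mG; apply/measurable_EFinP; apply: cmeasurable_normc.
  exact: cmeasurable_section.
move=> t; apply: ge0_Lnorm_le_sqrD => //; try exact: ms;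
  try (move=> x; rewrite lee_fin normc_ge0//).
by move=> x; rewrite /= !powR_mulrn ?normc_ge0// -EFinD lee_fin.
Qed.

End mixed_norm.

(** * Domination of a complex function by one of its real components *)

Section real_reduction.
Context {R : realType}.
Local Notation leb := (@lebesgue_measure R).
Implicit Types (u w : R -> R[i]) (F G : R * R -> R[i]).

Definition re_fun u : R -> R[i] := fun x => (complex.Re (u x))%:C.

Definition im_fun u : R -> R[i] := fun x => (complex.Im (u x))%:C.

Lemma cmeasurable_re_fun u : cmeasurable (u : measurableTypeR R -> R[i]) ->
  cmeasurable (re_fun u : measurableTypeR R -> R[i]).
Proof. by move=> [m1 m2]; exact: cmeasurable_real. Qed.

Lemma cmeasurable_im_fun u : cmeasurable (u : measurableTypeR R -> R[i]) ->
  cmeasurable (im_fun u : measurableTypeR R -> R[i]).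
Proof. by move=> [m1 m2]; exact: cmeasurable_real. Qed.

Lemma L2norm_fineK u : L2 u -> ((fine (L2norm u))%:E = L2norm u)%E.
Proof. by move=> [_ u2]; rewrite fineK// ge0_fin_numE// Lnorm_ge0. Qed.

Lemma L2norm_le u w : cmeasurable (u : measurableTypeR R -> R[i]) ->
  cmeasurable (w : measurableTypeR R -> R[i]) ->
  (forall x, normc (u x) <= normc (w x)) -> (L2norm u <= L2norm w)%E.
Proof.
move=> mu mw uw; apply: ge0_le_Lnorm => //.
- by apply/measurable_EFinP; exact: cmeasurable_normc.
- by apply/measurable_EFinP; exact: cmeasurable_normc.
- by move=> x; rewrite lee_fin normc_ge0.
Qed.

Lemma L2_re_fun u : L2 u -> L2 (re_fun u).
Proof.
move=> [mu u2]; split; first exact: cmeasurable_re_fun.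
apply: le_lt_trans u2; apply: L2norm_le => //; first exact: cmeasurable_re_fun.
by move=> x; rewrite normc_real normr_Re_le.
Qed.

Lemma L2_im_fun u : L2 u -> L2 (im_fun u).
Proof.
move=> [mu u2]; split; first exact: cmeasurable_im_fun.
apply: le_lt_trans u2; apply: L2norm_le => //; first exact: cmeasurable_im_fun.
by move=> x; rewrite normc_real normr_Im_le.
Qed.

Lemma sqr_L2norm_re_im u : L2 u ->
  fine (L2norm u) ^+ 2 =
  fine (L2norm (re_fun u)) ^+ 2 + fine (L2norm (im_fun u)) ^+ 2.
Proof.
move=> Lu; apply: EFin_inj.
have sq w : L2 w -> ((fine (L2norm w) ^+ 2)%:E = L2norm w `^ 2)%E.
  by move=> Lw; rewrite -[in RHS]L2norm_fineK//= powR_mulrn// fine_ge0// Lnorm_ge0.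
rewrite EFinD !sq//; [|exact: L2_im_fun|exact: L2_re_fun].
rewrite /L2norm !sqr_cLnorm2 -ge0_integralD//; last 4 first.
- by move=> x _; rewrite lee_fin sqr_ge0.
- apply/measurable_EFinP/measurable_funX/cmeasurable_normc/cmeasurable_re_fun.
  by case: Lu.
- by move=> x _; rewrite lee_fin sqr_ge0.
- apply/measurable_EFinP/measurable_funX/cmeasurable_normc/cmeasurable_im_fun.
  by case: Lu.
apply: eq_integral => x _; rewrite -EFinD !normc_real !real_normK ?num_real//.
by rewrite sqr_normc.
Qed.

Lemma airy_norm_ge0 (p q gamma : R) u : (0 <= airy_norm p q gamma u)%E.
Proof. by apply: le_ereal_inf_tmp => _ [F _ <-]; exact: mixed_norm_ge0. Qed.

Lemma airy_quotient_ge0 (p q gamma : R) u : (0 <= airy_quotient p q gamma u)%E.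
Proof. by rewrite mule_ge0 ?inve_ge0 ?airy_norm_ge0// Lnorm_ge0. Qed.

Lemma airy_quotient_ltE (p q gamma M : R) u : L2C_nonzero u ->
  (airy_quotient p q gamma u < M%:E)%E =
  (airy_norm p q gamma u < (M * fine (L2norm u))%:E)%E.
Proof.
move=> [Lu u0]; have n0 : 0 < fine (L2norm u).
  by rewrite -lte_fin L2norm_fineK// lt0e u0 Lnorm_ge0.
rewrite /airy_quotient -[in LHS]L2norm_fineK// inver gt_eqF//.
by rewrite lte_pdivrMr// EFinM.
Qed.

(** Both a weak and a conditional strict bound are recorded, because a [w] of norm zero only gives
    $0\le M\cdot 0$. *)
Lemma real_airy_representative (p q gamma M : R) w : 0 < p -> 0 < q ->
  L2 w -> (forall x, complex.Im (w x) = 0) ->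
  (L2norm w != 0 -> airy_quotient p q gamma w < M%:E)%E ->
  exists F, exists m : R, [/\ is_airy gamma w F,
    forall z, complex.Im (F z) = 0, (mixed_norm p q F = m%:E)%E,
    m <= M * fine (L2norm w) & L2norm w != 0%E -> m < M * fine (L2norm w)].
Proof.
move=> p0 q0 Lw wr Qw; have [w0|w0] := eqVneq (L2norm w) 0%E.
  exists (fun _ => 0), 0; split => //.
  - by apply: is_airy_ae0; [case: Lw|apply: L2norm_eq0_ae => //; case: Lw].
  - by rewrite mixed_norm0 ?gt_eqF.
  - by rewrite w0/= mulr0.
have {Qw} := Qw w0; rewrite airy_quotient_ltE// => /ereal_inf_lt[_ [F hF <-] ltF].
(* The real part still represents the evolution of [w] and has smaller modulus, so the strict bound
   survives. *)
pose F' z := (complex.Re (F z))%:C.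
have hF' : is_airy gamma w F' by exact: is_airy_Re.
have mF' : (mixed_norm p q F' <= mixed_norm p q F)%E.
  have [mF _] := hF; have [mF'' _] := hF'.
  apply: ge0_le_Lnorm => //; [exact: measurable_cLnorm_section..| |].
    by move=> t; exact: Lnorm_ge0.
  move=> t; apply: ge0_le_Lnorm => //.
  - by apply/measurable_EFinP/cmeasurable_normc; exact: (cmeasurable_section _ mF'').
  - by apply/measurable_EFinP/cmeasurable_normc; exact: (cmeasurable_section _ mF).
  - by move=> x; rewrite lee_fin normc_ge0.
  - by move=> x; rewrite lee_fin normc_real normr_Re_le.
have ltF' := le_lt_trans mF' ltF.
have fin : mixed_norm p q F' \is a fin_num.
  by rewrite ge0_fin_numE ?mixed_norm_ge0// (lt_trans ltF')// ltry.
exists F', (fine (mixed_norm p q F')); rewrite -(fineK fin) lte_fin in ltF'.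
by split => //; [rewrite fineK|exact: ltW].
Qed.

(* A real bound M instead of the maximum of the two quotients keeps the
   arithmetic in R when quotients are infinite. *)
Lemma airy_quotient_lt (p q gamma M : R) u : 2 <= p -> 2 <= q ->
  L2C_nonzero u ->
  (forall w, w = re_fun u \/ w = im_fun u -> L2norm w != 0%E ->
     airy_quotient p q gamma w < M%:E)%E ->
  (airy_quotient p q gamma u < M%:E)%E.
Proof.
move=> p2 q2 Lu0 hw; have [Lu u0] := Lu0.
have p0 : 0 < p by exact: lt_le_trans p2.
have q0 : 0 < q by exact: lt_le_trans q2.
have [F1 [m1 [a1 r1 e1 le1 lt1]]] := real_airy_representative p0 q0
  (L2_re_fun Lu) (fun=> erefl) (hw _ (or_introl erefl)).
have [F2 [m2 [a2 r2 e2 le2 lt2]]] := real_airy_representative p0 q0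
  (L2_im_fun Lu) (fun=> erefl) (hw _ (or_intror erefl)).
pose F z := 1 * F1 z + 'i * F2 z.
have hF : is_airy gamma u F.
  have := is_airy_lin 1 'i (L2_re_fun Lu) (L2_im_fun Lu) a1 a2.
  rewrite (_ : (fun x => _ + _) = u)//.
  by apply/funext => x; rewrite [RHS]complexE mul1r.
(* Equality holds here: [F1] and [F2] are real, hence they are the real and imaginary parts of
   [F]. *)
have nF z : normc (F z) ^+ 2 <= normc (F1 z) ^+ 2 + normc (F2 z) ^+ 2.
  rewrite !sqr_normc /F RecD ImcD !RecM !ImcM r1 r2 /=.
  by rewrite le_eqVlt; apply/orP; left; apply/eqP; ring.
have := mixed_norm_le_sqrD p2 q2 hF.1 a1.1 a2.1 nF.
have m1_ge0 : 0 <= m1 by rewrite -lee_fin -e1 mixed_norm_ge0.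
have m2_ge0 : 0 <= m2 by rewrite -lee_fin -e2 mixed_norm_ge0.
rewrite e1 e2 /= !powR_mulrn// => leF.
rewrite airy_quotient_ltE//.
have : (airy_norm p q gamma u <= mixed_norm p q F)%E.
  by apply: ereal_inf_lbound; exists F.
move=> /le_lt_trans; apply.
have := mixed_norm_ge0 p q F.
(* The bound by the finite $m_1^2+m_2^2$ excludes [+oo], and nonnegativity excludes [-oo]. *)
case: (mixed_norm p q F) leF => [m|//|//]; last by rewrite poweRyr.
rewrite /= -EFinD !lee_fin lte_fin => /[swap] m0; rewrite powR_mulrn// => lem.
have := sqr_L2norm_re_im Lu.
have n0 : 0 < fine (L2norm u).
  by rewrite -lte_fin L2norm_fineK// lt0e u0 Lnorm_ge0.
have z1 : L2norm (re_fun u) = 0%E -> fine (L2norm (re_fun u)) = 0 by move=> ->.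
have z2 : L2norm (im_fun u) = 0%E -> fine (L2norm (im_fun u)) = 0 by move=> ->.
have a_ge0 : 0 <= fine (L2norm (re_fun u)) by rewrite fine_ge0 ?Lnorm_ge0.
have b_ge0 : 0 <= fine (L2norm (im_fun u)) by rewrite fine_ge0 ?Lnorm_ge0.
move: n0 le1 le2 lt1 lt2 z1 z2 a_ge0 b_ge0.
set n := fine _; set a := fine _; set b := fine _.
move=> n0 le1 le2 lt1 lt2 z1 z2 a0 b0 nab.
(* Adding the weak bounds gives $0\le m_1+m_2\le M(a+b)$, and $a+b>0$ because $a^2+b^2=n^2>0$. The
   sign of [M] is what permits comparing squares below. *)
have M0 : 0 <= M.
  rewrite leNgt; apply/negP => M0.
  have : 0 <= M * (a + b) by rewrite mulrDr; lra.
  by have : 0 < a + b; nra.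
rewrite -(ltr_pXn2r (n := 2))// ?nnegrE ?mulr_ge0 ?(ltW n0)//.
rewrite exprMn nab mulrDr -!exprMn; apply: (le_lt_trans lem).
(* As [u] is nonzero, some component is nonzero; its bound is strict and the other may be weak. *)
have [wa|wa] := eqVneq (L2norm (re_fun u)) 0%E.
  have [wb|wb] := eqVneq (L2norm (im_fun u)) 0%E.
    by move: n0; rewrite (z1 wa) (z2 wb) in nab; nra.
  have {}lt2 := lt2 wb; rewrite ler_ltD//.
    by rewrite lerXn2r ?nnegrE ?mulr_ge0.
  by rewrite ltrXn2r ?nnegrE ?mulr_ge0.
have {}lt1 := lt1 wa; rewrite ltr_leD//.
  by rewrite ltrXn2r ?nnegrE ?mulr_ge0.
by rewrite lerXn2r ?nnegrE ?mulr_ge0.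
Qed.

(** If every nonzero real function had a strictly smaller quotient than [u], then [airy_quotient_lt]
    with [M] equal to the quotient of [u] would place that quotient strictly below itself. *)
Lemma exists_real_ge_airy_quotient (p q gamma : R) u : 2 <= p -> 2 <= q ->
  L2C_nonzero u -> exists2 w, L2R_nonzero w &
    (airy_quotient p q gamma u <= airy_quotient p q gamma w)%E.
Proof.
move=> p2 q2 Lu; have [Lu2 u0] := Lu; apply: contrapT => hno.
have lt w : L2R_nonzero w ->
    (airy_quotient p q gamma w < airy_quotient p q gamma u)%E.
  by move=> Lw; rewrite ltNge; apply/negP => h; apply: hno; exists w.
have real w : w = re_fun u \/ w = im_fun u -> L2norm w != 0%E -> L2R_nonzero w.
  by move=> [->|->] w0; split => //; split => //; [exact: L2_re_fun|exact: L2_im_fun].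
pose Q w := airy_quotient p q gamma w.
have [uoo|uoo] := eqVneq (Q u) +oo%E.
  (* When the quotient of [u] is infinite, those of its nonzero components are finite by assumption,
     and any real [M] above them is contradictory; the added 1 makes the bounds strict. A component
     of norm zero can only enlarge [M]. *)
  pose M := Num.max (fine (Q (re_fun u))) (fine (Q (im_fun u))) + 1.
  suff : (Q u < M%:E)%E by rewrite uoo.
  apply: airy_quotient_lt => // w hw w0.
  have woo : (Q w < +oo)%E by rewrite -uoo; exact/lt/real.
  rewrite -[airy_quotient _ _ _ _]/(Q w) -(@fineK _ (Q w)); last first.
    by rewrite ge0_fin_numE// airy_quotient_ge0.
  by rewrite lte_fin /M ltr_pwDr// le_max; case: hw => ->; rewrite lexx ?orbT.
have Qfin : Q u \is a fin_num.
  by rewrite ge0_fin_numE ?airy_quotient_ge0// ltey.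
have : (Q u < (fine (Q u))%:E)%E.
  by apply: airy_quotient_lt => // w hw w0; rewrite fineK//; exact/lt/real.
by rewrite fineK// ltxx.
Qed.

End real_reduction.

Theorem lemma2p8 (R : realType) (p q gamma : R) (hp : 2 <= p) (hq : 2 <= q) :
  airy_sup p q gamma L2C_nonzero = airy_sup p q gamma L2R_nonzero /\
  (has_maximizer p q gamma L2C_nonzero <-> has_maximizer p q gamma L2R_nonzero).
Proof.
have sup_eq : airy_sup p q gamma L2C_nonzero = airy_sup p q gamma L2R_nonzero.
  apply/eqP; rewrite eq_le; apply/andP; split.
    apply: ge_ereal_sup => _ [u Lu <-].
    have [w Lw le] := exists_real_ge_airy_quotient gamma hp hq Lu.
    by apply: (le_trans le); apply: ereal_sup_ubound; exists w.
  by apply: ereal_sup_le => _ [u [Lu _] <-]; exists u.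
split=> //; split=> [[u Lu Qu]|[u [Lu ur] Qu]]; last first.
  by exists u => //; rewrite Qu.
(* The real function dominating a complex maximizer reaches the common supremum, which also bounds
   it from above. *)
have [w Lw le] := exists_real_ge_airy_quotient gamma hp hq Lu.
exists w => //; apply/eqP; rewrite eq_le -{2}sup_eq -Qu le andbT.
by apply: ereal_sup_ubound; exists w.
Qed.
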